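(* Let $(X,E)$ be a finite connected weighted graph with weights $\mu,g$ and let $B\subset X$. Assume $(X,E)$ satisfies the Two-Points Condition with respect to $B$. Then for any potential $q:X\to\mathbb{R}$, there does not exist a nonzero eigenfunction of the Schrödinger operator $-\Delta_X+q$ vanishing identically on $B$.
   Context: Graphs are finite, undirected and simple; $x\sim y$ means $\{x,y\}\in E$. A weighted graph carries a measure $\mu_x>0$ on each vertex and a symmetric weight $g_{xy}=g_{yx}>0$ on each edge. The graph Laplacian is $(\Delta_X u)(x)=\frac{1}{\mu_x}\sum_{y\sim x,\,y\in X}g_{xy}(u(y)-u(x))$, $x\in X$, for $u:X\to\mathbb{R}$. An eigenfunction of $-\Delta_X+q$ is a function $\phi:X\to\mathbb{R}$ with $-\Delta_X\phi+q\phi=\lambda\phi$ on all of $X$ for some $\lambda\in\mathbb{R}$. The graph distance between two vertices is the minimal number of edges of a path joining them. Given $S\subset X$, a point $x_0\in S$ is an extreme point of $S$ with respect to $B$ if there exists $b\in B$ (possibly $b=x_0$) such that $x_0$ is the unique nearest point in $S$ from $b$ with respect to the graph distance on $(X,E)$. $(X,E)$ satisfies the Two-Points Condition with respect to $B$ if every subset $S\subset X$ with cardinality at least $2$ has at least two extreme points with respect to $B$.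
   Formalization: The set B is additionally assumed nonempty: for a single-vertex graph with B empty the Two-Points Condition is vacuous and the constant 1 is a nonzero eigenfunction vanishing on B; with at least two vertices nonemptiness follows from the condition. *)

(* Defs.v *)
From HB Require Import structures.
From mathcomp Require Import all_boot all_order all_algebra.
From mathcomp Require Import reals.

Set Implicit Arguments.
Unset Strict Implicit.
Unset Printing Implicit Defensive.

Import Order.TTheory GRing.Theory Num.Theory.

Local Open Scope ring_scope.

Definition simple_graph (X : finType) (adj : rel X) : Prop :=
  symmetric adj /\ irreflexive adj.

(* [g] is only constrained on edges; its values elsewhere are never used. *)
Definition graph_weights (R : realType) (X : finType) (adj : rel X)
    (mu : X -> R) (g : X -> X -> R) : Prop :=
  [/\ forall x, 0 < mu x,
      forall x y, adj x y -> 0 < g x y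
    & forall x y, adj x y -> g x y = g y x].

Definition connected_graph (X : finType) (adj : rel X) : Prop :=
  forall x y : X, connect adj x y.

Definition joined_by (X : finType) (adj : rel X) (x y : X) (n : nat) : bool :=
  [exists p : n.-tuple X, path adj x p && (last x p == y)].

(* The least [n] with [joined_by adj x y n]. Since shortest paths have fewer
   than [#|X|] edges, searching below [#|X|] suffices; the value is the dummy
   [#|X|] if [x] and [y] lie in different components. See [gdist_le] and
   [gdist_attained]. *)
Definition gdist (X : finType) (adj : rel X) (x y : X) : nat :=
  find (joined_by adj x y) (iota 0 #|X|).

Definition extreme_point (X : finType) (adj : rel X) (B S : {set X}) (x0 : X)
    : Prop :=
  x0 \in S /\
  exists2 b, b \in B &
    forall s, s \in S -> s != x0 -> (gdist adj b x0 < gdist adj b s)%N.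

Definition two_points_condition (X : finType) (adj : rel X) (B : {set X})
    : Prop :=
  forall S : {set X}, (2 <= #|S|)%N ->
    exists x y : X,
      [/\ x != y, extreme_point adj B S x & extreme_point adj B S y].

Definition laplacian (R : realType) (X : finType) (adj : rel X)
    (mu : X -> R) (g : X -> X -> R) (u : X -> R) (x : X) : R :=
  (mu x)^-1 * \sum_(y | adj x y) g x y * (u y - u x).

Definition schrodinger (R : realType) (X : finType) (adj : rel X)
    (mu : X -> R) (g : X -> X -> R) (q : X -> R) (u : X -> R) (x : X) : R :=
  - laplacian adj mu g u x + q x * u x.

(* The zero function is not excluded here. *)
Definition eigenfunction (R : realType) (X : finType) (adj : rel X)
    (mu : X -> R) (g : X -> X -> R) (q : X -> R) (phi : X -> R) : Prop :=
  exists lambda : R,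
    forall x, schrodinger adj mu g q phi x = lambda * phi x.

Lemma joined_byP (X : finType) (adj : rel X) (x y : X) (n : nat) :
  reflect (exists p : seq X, [/\ path adj x p, last x p = y & size p = n])
          (joined_by adj x y n).
Proof.
apply: (iffP existsP) => [[p /andP[pp /eqP lp]]|[p [pp lp sp]]].
  by exists p; rewrite size_tuple.
by move/eqP: sp => sp; exists (Tuple sp); rewrite /= pp lp eqxx.
Qed.

Lemma gdist_le (X : finType) (adj : rel X) (x : X) (p : seq X) :
  path adj x p -> (gdist adj x (last x p) <= size p)%N.
Proof.
move=> pp; rewrite /gdist; set P := joined_by _ _ _.
have [ltn|] := ltnP (size p) #|X|; last first.
  by apply: leq_trans; rewrite -[X in (_ <= X)%N](size_iota 0) find_size.
rewrite leqNgt; apply/negP => /(before_find 0%N).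
have Pp : P (size p) by rewrite /P; apply/joined_byP; exists p.
by rewrite nth_iota // add0n Pp.
Qed.

Lemma gdist_attained (X : finType) (adj : rel X) (x y : X) :
  connect adj x y ->
  exists p, [/\ path adj x p, last x p = y & size p = gdist adj x y].
Proof.
move=> /connectP[p0 pp0 ->]; case/shortenP: pp0 => p pp up _.
have ltn : (size p < #|X|)%N by rewrite -[(_ < _)%N]/(size (x :: p) <= _)%N
  -(card_uniqP up) max_card.
rewrite /gdist; set P := joined_by _ _ _.
have hP : has P (iota 0 #|X|).
  by apply/hasP; exists (size p); [rewrite mem_iota | rewrite /P; apply/joined_byP; exists p].
apply/joined_byP; have := nth_find 0%N hP; rewrite nth_iota ?add0n //.
by rewrite -[X in (_ < X)%N](size_iota 0) -has_find.
Qed.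

(* Main.v *)
Require Import Defs.
From HB Require Import structures.
From mathcomp Require Import all_boot all_order all_algebra.
From mathcomp Require Import reals.

Set Implicit Arguments.
Unset Strict Implicit.
Unset Printing Implicit Defensive.

Import Order.TTheory GRing.Theory Num.Theory.

Local Open Scope ring_scope.

(** Let [phi] be a nonzero eigenfunction vanishing on [B], and let [S] be its
    support. The Two-Points Condition provides an extreme point of [S]
    ([exists_extreme_point]): some [x0] in [S] that is the unique point of [S]
    nearest to some [b] in [B]. Since [phi b = 0], the points [x0] and [b]
    differ, so a shortest path from [b] to [x0] has a last vertex [y] before
    [x0]. This [y] is strictly closer to [b] than [x0], hence [phi y = 0], and
    all its neighbours are at distance at most [gdist adj b x0] from [b], hence
    [x0] is the only one where [phi] may be nonzero ([extreme_point_gate]).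
    The eigenvalue equation at [y] thus reduces to [g y x0 * phi x0 = 0]
    ([eigenfunction_vanishing]), which is impossible. *)

(** A set with at least two points has an extreme point by the Two-Points
    Condition; the only point of a singleton is extreme with respect to any
    point of [B]. *)
Lemma exists_extreme_point (X : finType) (adj : rel X) (B S : {set X}) :
  two_points_condition adj B -> B != set0 -> S != set0 ->
  exists x0, extreme_point adj B S x0.
Proof.
move=> two_points /set0Pn[b bB] S_neq0.
have [/two_points[x [_ [_ ext_x _]]] | S_le1] := leqP 2 #|S|; first by exists x.
have /cards1P[x0 ->] : #|S| == 1%N.
  by rewrite eqn_leq -ltnS S_le1 card_gt0.
exists x0; split; first exact: set11.
by exists b => // s /set1P-> /eqP.
Qed.

(** The vertex [y] is the one preceding [x0] on a shortest path from [b]. *)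
Lemma extreme_point_gate (X : finType) (adj : rel X) (S : {set X}) (b x0 : X) :
  connect adj b x0 -> b \notin S -> x0 \in S ->
  (forall s, s \in S -> s != x0 -> (gdist adj b x0 < gdist adj b s)%N) ->
  exists y, [/\ adj y x0, y \notin S
               & forall z, adj y z -> z \in S -> z = x0].
Proof.
move=> /gdist_attained[p [path_p last_p size_p]] bNS x0S x0_nearest.
case/lastP: p => [|p x] in path_p last_p size_p *.
  by move: bNS; rewrite -[b]/(last b [::]) last_p x0S.
move: path_p last_p size_p; rewrite rcons_path last_rcons size_rcons.
move=> /andP[path_p adj_x] eq_x size_p; subst x.
have near z : (gdist adj b z <= gdist adj b x0)%N -> z \in S -> z = x0.
  move=> le_z zS; apply/eqP; apply: contraTT le_z => z_neq.
  by rewrite -ltnNge x0_nearest.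
have lt_y : (gdist adj b (last b p) < gdist adj b x0)%N.
  by rewrite -size_p ltnS gdist_le.
exists (last b p); split=> // [|z adj_z].
  apply: contraL (lt_y) => yS.
  by rewrite (near _ (ltnW lt_y) yS) ltnn.
apply: near; rewrite -size_p -(size_rcons p z) -[z in X in (X <= _)%N](last_rcons b p).
by apply: gdist_le; rewrite rcons_path path_p.
Qed.

(** At a zero [y] of an eigenfunction the potential, the eigenvalue and the
    diagonal part of the Laplacian all drop out, leaving a weighted sum of the
    values at the neighbours of [y]. If at most one of those values can be
    nonzero, the equation forces it to vanish too. *)
Lemma eigenfunction_vanishing (R : realType) (X : finType) (adj : rel X)
    (mu : X -> R) (g : X -> X -> R) (q phi : X -> R) (y x0 : X) :
  graph_weights adj mu g -> eigenfunction adj mu g q phi ->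
  phi y = 0 -> adj y x0 ->
  (forall z, adj y z -> z != x0 -> phi z = 0) -> phi x0 = 0.
Proof.
move=> [mu_gt0 g_gt0 _] [lambda /(_ y)] + phi_y adj_x0 phi_nbr.
rewrite /schrodinger /laplacian phi_y !mulr0 addr0 (bigD1 x0) //=.
rewrite big1 => [|z /andP[adj_z z_neq]]; last by rewrite phi_nbr // subr0 mulr0.
rewrite subr0 addr0 => /eqP.
rewrite oppr_eq0 !mulf_eq0 invr_eq0 gt_eqF //= gt_eqF ?g_gt0 //=.
by move/eqP.
Qed.

Theorem proposition2p6 (R : realType) (X : finType) (adj : rel X)
    (mu : X -> R) (g : X -> X -> R) (B : {set X})
    (graph_adj : simple_graph adj)
    (conn_adj : connected_graph adj)
    (weights : graph_weights adj mu g)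
    (B_nonempty : B != set0)
    (two_points : two_points_condition adj B)
    (q : X -> R) :
  ~ exists phi : X -> R,
      [/\ eigenfunction adj mu g q phi,
          exists x, phi x != 0
        & forall b, b \in B -> phi b = 0].
Proof.
case=> phi [eig_phi [x phi_x] phi_B].
pose S := [set z | phi z != 0].
have S_neq0 : S != set0 by apply/set0Pn; exists x; rewrite inE.
have [x0 [x0S [b bB x0_nearest]]] :=
  exists_extreme_point two_points B_nonempty S_neq0.
have bNS : b \notin S by rewrite inE phi_B ?eqxx.
have [y [adj_y yNS y_nbr]] :=
  extreme_point_gate (conn_adj b x0) bNS x0S x0_nearest.
have phi_y : phi y = 0 by move: yNS; rewrite inE negbK => /eqP.
move: x0S; rewrite inE => /eqP; apply.
apply: (eigenfunction_vanishing weights eig_phi phi_y adj_y) => z adj_z.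
apply: contraNeq => phi_z; apply/eqP/y_nbr => //.
by rewrite inE.
Qed.
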